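(* Let $G\cong(\underbrace{0,\ldots,0}_{k_1},1,0,1,\underbrace{0,\ldots,0}_{k_2},1)$, where $k_1,k_2\ge 1$. Then $q(G)=3$.
   Context: For a simple graph $G$ on $n$ vertices, $S(G)$ is the set of all real symmetric $n\times n$ matrices $A=(a_{ij})$ such that for $i\neq j$, $a_{ij}\neq 0$ if and only if $ij\in E(G)$ (diagonal entries are unrestricted). $q(A)$ is the number of distinct eigenvalues of $A$ and $q(G)=\min\{q(A): A\in S(G)\}$. The notation $G\cong(b_1,\ldots,b_n)$, with $b_i\in\{0,1\}$ and $b_1=0$, means that $G$ is the threshold graph with creation sequence $(b_1,\ldots,b_n)$: its vertices are $v_1,\ldots,v_n$ and, for $i<j$, $v_i$ and $v_j$ are adjacent if and only if $b_j=1$. *)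

(* Defs.v *)
From mathcomp Require Import all_boot all_order all_algebra finmap.
From mathcomp Require Import boolp classical_sets cardinality reals.

Set Implicit Arguments.
Unset Strict Implicit.
Unset Printing Implicit Defensive.

Import GRing.Theory.
Local Open Scope ring_scope.
Local Open Scope classical_set_scope.

Record sgraph (n : nat) := SGraph {
  adj :> rel 'I_n;
  adj_sym : symmetric adj;
  adj_irr : irreflexive adj }.

(* S(G) *)
Definition sym_mx_of (R : realType) (n : nat) (G : sgraph n) : set 'M[R]_n :=
  [set A | A^T = A /\ forall i j, i != j -> (A i j != 0 <-> G i j)].

(* q(A); the set of eigenvalues of a matrix is always finite, so [fset_set]
   never takes its default value here. *)
Definition num_eigenvalues (R : realType) (n : nat) (A : 'M[R]_n) : nat :=
  #|` fset_set [set a : R | eigenvalue A a]|.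

Lemma ex_num_eigenvalues (R : realType) (n : nat) (G : sgraph n) :
  exists k, `[< exists2 A : 'M[R]_n, sym_mx_of G A & num_eigenvalues A = k >].
Proof.
pose A : 'M[R]_n := \matrix_(i, j) (G i j)%:R.
exists (num_eigenvalues A); apply/asboolP; exists A => //; split.
  by apply/matrixP => i j; rewrite !mxE adj_sym.
by move=> i j _; rewrite mxE; case: (G i j); rewrite ?oner_neq0 ?eqxx.
Qed.

(* q(G) *)
Definition min_num_eigenvalues (R : realType) (n : nat) (G : sgraph n) : nat :=
  ex_minn (ex_num_eigenvalues R G).

(* G is, up to the names of its vertices, the threshold graph with creation
   sequence b. The entries b_1, ..., b_n are [nth false b 0], ...,
   [nth false b n.-1], and [~~ head true b] says that b_1 exists and is 0. *)
Definition is_threshold (n : nat) (G : sgraph n) (b : seq bool) : Prop :=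
  ~~ head true b /\
  exists2 v : 'I_(size b) -> 'I_n, bijective v &
    forall i j : 'I_(size b), (i < j)%N -> G (v i) (v j) = nth false b j.

(* Main.v *)
Require Import Defs.
From mathcomp Require Import all_boot all_order all_algebra reals.
From mathcomp Require Import finmap boolp classical_sets cardinality complex.
From mathcomp Require Import ring zify.

(* Lower bound: the second 0 of the creation sequence and a 0 of the last block
   are non-adjacent and have the final dominating vertex as their only common
   neighbour, so the corresponding entry of A^2 is non-zero. A symmetric matrix
   with at most two eigenvalues is annihilated by a polynomial of degree 2, which
   would force that entry of A^2 to vanish.

   Upper bound: merging each block of 0s into a single vertex gives a graph on 6
   vertices, and a matrix H of that graph with three eigenvalues, one of which is
   0, and with zero diagonal entries at the two merged vertices, can be blown up
   to W^T H W, where the row of W at a merged vertex spreads its weight evenly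
   over the block. Up to the multiplicity of 0 the spectrum does not change. *)

Set Implicit Arguments.
Unset Strict Implicit.
Unset Printing Implicit Defensive.

Import Order.TTheory GRing.Theory Num.Theory.
Local Open Scope ring_scope.

(** * Polynomials annihilating a real symmetric matrix *)

(** Over [R[i]] the matrix is Hermitian, hence diagonalisable with a real diagonal; each diagonal
    entry is an eigenvalue of [A], so [p] kills it. *)
Lemma horner_mx_sym (R : rcfType) n (A : 'M[R]_n.+1) (p : {poly R}) :
  A^T = A -> (forall a, eigenvalue A a -> root p a) -> horner_mx A p = 0.
Proof.
move=> Asym rootp; pose f : {rmorphism R -> R[i]} := real_complex R.
pose B := map_mx f A.
have Bherm : B \is hermsymmx.
  apply: realsym_hermsym.
    apply/is_hermitianmxP; rewrite expr0 scale1r.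
    by apply/matrixP => i j; rewrite !mxE /= -[in LHS]Asym mxE.
  by apply/mxOverP => i j; rewrite mxE; apply/complex_realP; exists (A i j).
have /mxOverP Breal := hermitian_spectral_diag_real Bherm.
have /orthomx_spectralP := hermitian_normalmx Bherm.
move: Breal (spectral_unit B).
move: (spectralmx B) (spectral_diag B) => P d Breal Pu defB.
apply: (@map_mx_inj _ _ f); rewrite map_mx0 map_horner_mx -/B {1}defB.
rewrite horner_mx_uconjC // horner_mx_diag.
suff -> : map_mx (horner (map_poly f p)) d = 0.
  by rewrite linear0 mulmx0 mul0mx.
apply/rowP => i; rewrite !mxE.
have /complex_realP[a da] := Breal 0 i.
have fa : d 0 i = f a by rewrite da.
rewrite fa horner_map /=; apply/eqP; rewrite fmorph_eq0; apply: rootp.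
rewrite -(eigenvalue_map f) -/B -fa; apply/eigenvalueP.
(* Since [B] is [P^-1 (diag d) P], row [i] of [P] is a left eigenvector for [d 0 i]. *)
exists (delta_mx 0 i *m P); last first.
  rewrite mulmx_free_eq0 ?row_free_unit //.
  by apply/eqP => /matrixP /(_ 0 i) /eqP; rewrite !mxE !eqxx oner_eq0.
rewrite [in LHS]defB !mulmxA mulmxK //.
by rewrite -(rowE i (diag_mx d)) row_diag_mx scalemxAl.
Qed.

Section Eigenvalues.
Variables (R : realType) (n : nat) (A : 'M[R]_n).

Lemma finite_eigenvalues : finite_set [set a : R | eigenvalue A a]%classic.
Proof.
apply: contrapT => /(infinite_set_fset (size (char_poly A))) [X XA].
rewrite leqNgt => /negP; apply; apply: max_poly_roots (fset_uniq X).
  by rewrite monic_neq0 ?char_poly_monic.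
by apply/allP => a aX; rewrite -eigenvalue_root_char; apply: XA.
Qed.

Lemma num_eigenvalues_le (s : seq R) :
  (forall a, eigenvalue A a -> a \in s) -> (num_eigenvalues A <= size s)%N.
Proof.
move=> As; apply: uniq_leq_size (fset_uniq _) _ => a.
by rewrite in_fset_set ?inE; [exact: As | exact: finite_eigenvalues].
Qed.

Lemma eigenvalue_seq :
  exists2 s : seq R, size s = num_eigenvalues A &
    forall a, eigenvalue A a -> a \in s.
Proof.
exists (enum_fset (fset_set [set a : R | eigenvalue A a]%classic)) => // a Aa.
by rewrite in_fset_set ?inE //; exact: finite_eigenvalues.
Qed.

End Eigenvalues.

Lemma sym_mul_eq0 (R : realType) n (A : 'M[R]_n) i j :
  A^T = A -> (num_eigenvalues A <= 2)%N -> i != j -> A i j = 0 ->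
  \sum_l A i l * A l j = 0.
Proof.
case: n A i j => [|n] A i j Asym; first by case: i.
have [s <- sP] := eigenvalue_seq A => szs neq_ij Aij.
(* If [s] has fewer than two entries, the default 0 only gives [p] a harmless extra root. *)
pose p := ('X - (s`_0)%:P) * ('X - (s`_1)%:P).
have /matrixP/(_ i j) : horner_mx A p = 0.
  apply: horner_mx_sym => // a /sP.
  rewrite rootM !root_XsubC; case: s szs {sP p} => [|x [|y []]] //= _.
    by rewrite inE => ->.
  by rewrite !inE.
rewrite rmorphM !rmorphB /= horner_mx_X !horner_mx_C mulrBl !mulrBr.
rewrite -!mulmxE !mul_mx_scalar mul_scalar_mx !mxE Aij (negPf neq_ij).
by rewrite !(mulr0n, mulr0, subr0).
Qed.

(** * The weighted matrix on six cells *)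

(* Rows and columns are the cells of [cell_seq]. For this matrix h and
   D = diag(1, 1, 1, 1, 13, 1), h D has the eigenvalues 0, 9 and -26. On the
   cells 0, ..., 3, h / 9 is 1 - X^T X with X = (1 1 0 1; 0 0 1/3 4/3), so that 1
   is a double eigenvalue; as 1 is also an eigenvalue of X X^T, the other two are
   0 and -26/9. The column of the last cell is a multiple of the kernel vector
   (-2, -2, 1, 2) of this block, and it is scaled, together with the 13 in D and
   the -17, so that no fourth eigenvalue appears. *)
Definition quotient_rows : seq (seq int) :=
  [:: [::  0; -9;  0;  -9; 0;  -6];
      [:: -9;  0;  0;  -9; 0;  -6];
      [::  0;  0;  8;  -4; 0;   3];
      [:: -9; -9; -4; -16; 0;   6];
      [::  0;  0;  0;   0; 0;   3];
      [:: -6; -6;  3;   6; 3; -17]].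

Definition quotient_entry (k l : nat) : int := (nth [::] quotient_rows k)`_l.

Definition gram_weight (k : nat) : int := if k == 4 then 13 else 1.

(* The matrix product f D h, in the notation of [quotient_rows]. *)
Definition quotient_mul (f : nat -> nat -> int) (k l : nat) : int :=
  \sum_(m <- iota 0 6) gram_weight m * (f k m * quotient_entry m l).

Lemma all_iota2P (n : nat) (P : nat -> nat -> bool) :
  reflect (forall k l, (k < n)%N -> (l < n)%N -> P k l)
          (all (fun k => all (P k) (iota 0 n)) (iota 0 n)).
Proof.
apply: (iffP allP) => [allP_ k l kn ln | Pn k].
  have /allP/(_ l) : all (P k) (iota 0 n) by apply: allP_; rewrite mem_iota.
  by rewrite mem_iota; apply.
by rewrite mem_iota => kn; apply/allP => l; rewrite mem_iota; apply: Pn.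
Qed.

Lemma quotient_entryC k l : (k < 6)%N -> (l < 6)%N ->
  quotient_entry k l = quotient_entry l k.
Proof.
move=> k6 l6; apply/eqP; move: k l k6 l6.
by apply/(all_iota2P 6 (fun k l => quotient_entry k l == quotient_entry l k)).
Qed.

(** In matrix form, h D h D h + 17 h D h = 234 h, where t^3 + 17 t^2 - 234 t = t (t - 9) (t + 26)
    has the three intended eigenvalues as roots. *)
Lemma quotient_cubic k l : (k < 6)%N -> (l < 6)%N ->
  quotient_mul (quotient_mul quotient_entry) k l
  + 17 * quotient_mul quotient_entry k l = 234 * quotient_entry k l.
Proof.
move=> k6 l6; apply/eqP; move: k l k6 l6.
apply/(all_iota2P 6 (fun k l =>
  quotient_mul (quotient_mul quotient_entry) k l
  + 17 * quotient_mul quotient_entry k l == 234 * quotient_entry k l)).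
by rewrite /quotient_mul unlock; vm_compute.
Qed.

Definition cell_seq (k1 k2 : nat) : seq nat :=
  nseq k1 0 ++ [:: 1; 2; 3] ++ nseq k2 4 ++ [:: 5].

(* The squared weights of the vertices in cell k add up to [gram_weight k]. *)
Definition cell_weight (R : realType) (k1 k2 k : nat) : R :=
  if k == 0 then (Num.sqrt k1%:R)^-1
  else if k == 4 then Num.sqrt (13 / k2%:R) else 1.

Lemma cell_lt k1 k2 : all (fun k => k < 6)%N (cell_seq k1 k2).
Proof. by rewrite /cell_seq !all_cat !all_nseq /= !orbT. Qed.

Lemma cell_weight_neq0 (R : realType) k1 k2 k : (0 < k1)%N -> (0 < k2)%N ->
  cell_weight R k1 k2 k != 0.
Proof.
move=> k1_gt0 k2_gt0; rewrite /cell_weight; do 2?case: ifP => _.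
- by rewrite invr_neq0 // gt_eqF // sqrtr_gt0 ltr0n.
- by rewrite gt_eqF // sqrtr_gt0 divr_gt0 ?ltr0n.
- exact: oner_neq0.
Qed.

Lemma sum_cell_weight (R : realType) k1 k2 (F : nat -> int) :
    (0 < k1)%N -> (0 < k2)%N ->
  \sum_(k <- cell_seq k1 k2) cell_weight R k1 k2 k ^+ 2 * (F k)%:~R
    = (\sum_(k <- iota 0 6) gram_weight k * F k)%:~R.
Proof.
move=> k1_gt0 k2_gt0.
rewrite !big_cat !big_nseq !iter_addr_0 /= !big_cons !big_nil.
rewrite /cell_weight /gram_weight /= !mul1r !expr1n !mul1r !rmorphD rmorphM /=.
rewrite exprVn !sqr_sqrtr ?divr_ge0 ?ler0n //.
have k1R : k1%:R != 0 :> R by rewrite pnatr_eq0 -lt0n.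
have k2R : k2%:R != 0 :> R by rewrite pnatr_eq0 -lt0n.
rewrite -[in LHS]mulr_natr -[X in _ + (_ + (X + _))]mulr_natr.
by field; apply/andP.
Qed.

Lemma pairwise_nseq (T : Type) (e : rel T) n x : e x x -> pairwise e (nseq n x).
Proof. by move=> exx; elim: n => //= n ->; rewrite all_nseq exx orbT. Qed.

Definition cell_dominating (k : nat) : bool := k \in [:: 1; 3; 5].

(** Two positions in the same block meet a diagonal entry, at cell 0 or 4; it is 0, as a block of
    non-dominating vertices requires. *)
Lemma cell_adjacent k1 k2 :
  pairwise (fun k l => (quotient_entry k l != 0) == cell_dominating l)
    (cell_seq k1 k2).
Proof.
rewrite !pairwise_cat !allrel_catr !pairwise_nseq //.
by rewrite /allrel /= !all_nseq /= !all_nseq /= !orbT.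
Qed.

(** * The blow-up and its cubic equation *)

Section Realisation.
Variables (R : realType) (k1 k2 n : nat).
Hypotheses (k1_gt0 : (0 < k1)%N) (k2_gt0 : (0 < k2)%N).
Local Notation s := (cell_seq k1 k2).
Local Notation w := (cell_weight R k1 k2).
Variables (v : 'I_(size s) -> 'I_n) (u : 'I_n -> 'I_(size s)).
Hypotheses (vK : cancel v u) (uK : cancel u v).

Local Notation cell i := (nth 0%N s (u i)).

Definition blowup_mx (f : nat -> nat -> int) : 'M[R]_n :=
  \matrix_(i, j) (w (cell i) * w (cell j) * (f (cell i) (cell j))%:~R).

(** Let V have entry [w (cell i)] in row [cell i] of column i, and 0 elsewhere. Then [blowup_mx f]
    is V^T f V, and V V^T = D by [sum_cell_weight], so the product is V^T (f D h) V. *)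
Lemma blowup_mxM f :
  blowup_mx f *m blowup_mx quotient_entry = blowup_mx (quotient_mul f).
Proof.
apply/matrixP => i j; rewrite !mxE -(sum_cell_weight R _ k1_gt0 k2_gt0).
rewrite (big_nth 0%N) big_mkord.
rewrite (reindex v) /=; last by exists u => l _; rewrite ?vK ?uK.
rewrite mulr_sumr; apply: eq_bigr => l _; rewrite !mxE vK rmorphM; ring.
Qed.

Lemma blowup_cubic (A := blowup_mx quotient_entry) :
  A *m A *m A + 17 *: (A *m A) = 234 *: A.
Proof.
rewrite /A !blowup_mxM; apply/matrixP => i j; rewrite !mxE.
have c6 (l : 'I_n) : (cell l < 6)%N by apply: all_nthP (cell_lt k1 k2) _ _.
rewrite mulrCA -mulrDr [RHS]mulrCA; congr (_ * _).
have /(congr1 (intr : int -> R)) := quotient_cubic (c6 i) (c6 j).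
by rewrite rmorphD !rmorphM.
Qed.

End Realisation.

Lemma eigenvalue_cubic (F : fieldType) n (A : 'M[F]_n) (a b c : F) :
    A *m A *m A + b *: (A *m A) = c *: A -> eigenvalue A a ->
  a ^+ 3 + b * a ^+ 2 = c * a.
Proof.
move=> eqA /eigenvalueP[x xA nzx].
have /eqP := congr1 (mulmx x) eqA.
rewrite mulmxDr -!scalemxAr !mulmxA !(xA, =^~ scalemxAl) !scalerA -scalerDl.
rewrite -subr_eq0 -scalerBl scaler_eq0 (negPf nzx) orbF subr_eq0 => /eqP <-.
by ring.
Qed.

(** * The two bounds for the threshold graph *)

Section Threshold.
Variables (R : realType) (k1 k2 n : nat) (G : sgraph n).
Hypothesis k2_gt0 : (0 < k2)%N.
Local Notation s := (cell_seq k1 k2).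
Local Notation cell i := (nth 0%N s i).
Variable (v : 'I_(size s) -> 'I_n).
Hypothesis v_bij : bijective v.
Hypothesis Gv : forall i j : 'I_(size s),
  (i < j)%N -> G (v i) (v j) = cell_dominating (cell j).

Lemma size_cell_seq : size s = (k1 + k2 + 4)%N.
Proof. by rewrite !size_cat !size_nseq /=; lia. Qed.

Lemma num_eigenvalues_gt2 (A : 'M[R]_n) :
  sym_mx_of G A -> (2 < num_eigenvalues A)%N.
Proof.
move=> [Asym adjA]; rewrite ltnNge; apply/negP => A2.
have [u vK uK] := v_bij.
have v_inj : injective v := can_inj vK.
have z_lt : (k1 + 1 < size s)%N by rewrite size_cell_seq; lia.
have y_lt : (k1 + 3 < size s)%N by rewrite size_cell_seq; lia.
have d_lt : (k1 + k2 + 3 < size s)%N by rewrite size_cell_seq; lia.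
(* [z] is the vertex of cell 2, [y] the first vertex of the last block of 0s, and [d] the final
   dominating vertex. *)
pose z := Ordinal z_lt; pose y := Ordinal y_lt; pose d := Ordinal d_lt.
have cell4 m : (k1 + 3 <= m < k1 + k2 + 3)%N -> cell m = 4%N.
  move=> mP; rewrite !nth_cat !size_nseq /=.
  do 2!(rewrite ifF; last lia); rewrite ifT; last lia.
  by rewrite nth_nseq ifT //; lia.
have cell_d : cell d = 5%N.
  rewrite /= !nth_cat !size_nseq /=; do 3!(rewrite ifF; last lia).
  by rewrite (_ : (_ - _ - _ - _)%N = 0%N) //; lia.
have AvP (i j : 'I_(size s)) : (i < j)%N ->
    (A (v i) (v j) != 0) = cell_dominating (cell j).
  move=> ij; rewrite -(Gv ij).
  have neq_ij : v i != v j by rewrite inj_eq // neq_ltn ij.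
  by apply/idP/idP => /adjA; apply.
(* Only [d] is adjacent to [y]: no earlier vertex is, because [y] is not dominating, and those
   strictly between [y] and [d] lie in the same block. *)
have Ay m : m != y -> m != d -> A (v m) (v y) = 0.
  move=> my md; apply/eqP; apply: negbNE.
  have [lt_my|lt_ym|/val_inj eq_my] := ltngtP m y;
      last by rewrite eq_my eqxx in my.
    by rewrite AvP // cell4 //=; lia.
  rewrite -Asym mxE AvP // cell4 //.
  have m_lt : (m < k1 + k2 + 4)%N by rewrite -size_cell_seq.
  by move: lt_ym md; rewrite -val_eqE /=; lia.
have zy : z != y by apply/eqP => /(congr1 val) /=; lia.
have := sym_mul_eq0 Asym A2 (_ : v z != v y) (Ay z zy _).
rewrite inj_eq // => /(_ zy).
have zd : z != d by apply/eqP => /(congr1 val) /=; lia.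
move=> /(_ zd) /eqP; rewrite (bigD1 (v d)) //= big1 => [|l ld].
  have -> : A (v d) (v y) = A (v y) (v d) by rewrite -[in LHS]Asym mxE.
  rewrite addr0; apply/negP; rewrite mulf_eq0 negb_or.
  by rewrite !AvP ?cell_d //=; lia.
(* The diagonal entry at [y] is unrestricted, so for that term the factor at [z] and [y] provides
   the zero. *)
rewrite -(uK l); have [->|ly] := eqVneq (u l) y; first by rewrite Ay ?mul0r.
by rewrite Ay ?mulr0 //; apply: contraNneq ld => <-; rewrite uK.
Qed.

Hypothesis k1_gt0 : (0 < k1)%N.

Lemma exists_num_eigenvalues_le3 : exists2 A : 'M[R]_n,
  sym_mx_of G A & (num_eigenvalues A <= 3)%N.
Proof.
have [u vK uK] := v_bij.
have c6 (l : 'I_n) : (cell (u l) < 6)%N by apply: all_nthP (cell_lt k1 k2) _ _.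
exists (blowup_mx R u quotient_entry); last first.
  apply: (num_eigenvalues_le (s := [:: 0; 9; -26])) => a.
  move=> /(eigenvalue_cubic (blowup_cubic R k1_gt0 k2_gt0 vK uK)) a3.
  have : a * (a - 9) * (a + 26) = 0 by rewrite -(subrr (234 * a)) -{1}a3; ring.
  move/eqP; rewrite !mulf_eq0 subr_eq0 addr_eq0 !inE.
  by rewrite orbA.
have symA : (blowup_mx R u quotient_entry)^T = blowup_mx R u quotient_entry.
  apply/matrixP => i j; rewrite !mxE quotient_entryC //.
  by congr (_ * _); rewrite mulrC.
split=> //.
have adjP i j : (u i < u j)%N ->
   (blowup_mx R u quotient_entry i j != 0) = G i j.
  move=> ij; rewrite -[in RHS](uK i) -[in RHS](uK j) (Gv ij) mxE.
  rewrite !mulf_eq0 !(negPf (cell_weight_neq0 R _ k1_gt0 k2_gt0)) /= intr_eq0.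
  have /(pairwiseP 0%N)/(_ (u i) (u j)) := cell_adjacent k1 k2.
  by rewrite !inE !ltn_ord => /(_ isT isT ij)/eqP.
move=> i j; rewrite -(inj_eq (can_inj uK)) neq_ltn => /orP[] ij.
  by rewrite adjP.
by rewrite -symA mxE adj_sym -adjP.
Qed.

End Threshold.

Local Close Scope ring_scope.

Theorem theorem7p1 (R : realType) (k1 k2 n : nat) (G : sgraph n)
  (hk1 : 1 <= k1) (hk2 : 1 <= k2)
  (hG : is_threshold G
    (nseq k1 false ++ [:: true; false; true] ++ nseq k2 false ++ [:: true])) :
  min_num_eigenvalues R G = 3.
Proof.
have seqE : nseq k1 false ++ [:: true; false; true] ++ nseq k2 false ++ [:: true]
    = map cell_dominating (cell_seq k1 k2).
  by rewrite !map_cat !map_nseq.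
move: hG => [_]; rewrite seqE size_map => -[v v_bij adj_v].
have Gv (i j : 'I_(size (cell_seq k1 k2))) : i < j ->
    G (v i) (v j) = cell_dominating (nth 0 (cell_seq k1 k2) j).
  by move=> ij; rewrite adj_v // (nth_map 0).
have [A GA A3] := exists_num_eigenvalues_le3 R hk2 v_bij Gv hk1.
rewrite /min_num_eigenvalues; case: ex_minnP => m /asboolP[B GB <-] min_m.
apply/eqP; rewrite eqn_leq (num_eigenvalues_gt2 hk2 v_bij Gv GB) andbT.
by apply: leq_trans A3; apply: min_m; apply/asboolP; exists A.
Qed.
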